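(* Let $\alpha,\beta\in[0,1)$, $\gamma>0$, $\delta\geq 1$ and $u>0$. Let $(X,Y)$ be a random vector such that $X$ and $Y$ both have standard Laplace marginal distributions and such that for all $x>u$ and all $y\in\mathbb{R}$ $$\mathbb{P}(Y>y\mid X=x)=\overline{H}\left(\frac{y-\alpha x}{x^{\beta}}\right),\qquad \overline{H}(z)=\exp\left(-\gamma z^{\delta}\right)\mathbb{1}\{z>0\}+\mathbb{1}\{z\leq 0\}.$$ Then $\delta\geq(1-\beta)^{-1}$.
   Context: The standard Laplace distribution has density $\tfrac12 e^{-|x|}$ on $\mathbb{R}$. $\mathbb{1}$ denotes an indicator function. *)

(* Defs.v *)
From HB Require Import structures.
From mathcomp Require Import all_boot all_order all_algebra.
From mathcomp Require Import all_classical all_reals all_analysis.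
Set Implicit Arguments.
Unset Strict Implicit.
Unset Printing Implicit Defensive.
Import Order.TTheory GRing.Theory Num.Theory.
Import numFieldNormedType.Exports.
Local Open Scope classical_set_scope.
Local Open Scope ring_scope.

Definition laplace_pdf {R : realType} (x : R) : R := 2^-1 * expR (- `|x|).

Definition laplace_prob {R : realType} (A : set R) : \bar R :=
  (\int[lebesgue_measure]_(x in A) (laplace_pdf x)%:E)%E.

Definition standard_laplace d (T : measurableType d) (R : realType)
    (P : probability T R) (X : {RV P >-> R}) : Prop :=
  forall A : set R, measurable A -> distribution P X A = laplace_prob A.

(* [k] is a regular conditional distribution of [Y] given [X]: [k x B] is a
   version of P(Y \in B | X = x).  It is determined by the law of [(X, Y)] only
   up to an [X]-null set of values [x], so statements about P(Y \in B | X = x)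
   for each single [x] refer to a chosen version [k]. *)
Definition regular_cond_distribution d (T : measurableType d) (R : realType)
    (P : probability T R) (X Y : {RV P >-> R}) (k : R.-pker R ~> R) : Prop :=
  forall A B : set R, measurable A -> measurable B ->
    P (X @^-1` A `&` Y @^-1` B) = (\int[distribution P X]_(x in A) k x B)%E.

Definition Hbar {R : realType} (gamma delta z : R) : R :=
  expR (- (gamma * z `^ delta)) * \1_[set w : R | 0 < w] z
  + \1_[set w : R | w <= 0] z.

(* Main.v *)
Require Import Defs.
From HB Require Import structures.
From mathcomp Require Import all_boot all_order all_algebra.
From mathcomp Require Import all_classical all_reals all_analysis.
From mathcomp Require Import measurable_realfun lra.
Import Order.TTheory GRing.Theory Num.Theory.
Import numFieldNormedType.Exports.
Local Open Scope classical_set_scope.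
Local Open Scope ring_scope.

(** If [delta * (1 - beta) < 1], then for [X] between [t] and [2t] the conditional
    probability that [Y > 4t] is only subexponentially small in [t], so
    P(Y > 4t) is at least of order exp(- 2t - o(t)), whereas the Laplace
    marginal of [Y] forces it to be at most exp(- 4t). *)

Lemma laplace_pdf_ge0 (R : realType) (x : R) : 0 <= laplace_pdf x.
Proof. by rewrite mulr_ge0 ?expR_ge0// invr_ge0. Qed.

Lemma continuous_laplace_pdf (R : realType) : continuous (@laplace_pdf R).
Proof.
move=> x; apply: cvgM; first exact: cvg_cst.
apply: continuous_comp; last exact: continuous_expR.
by apply: cvgN; exact: norm_continuous.
Qed.

Lemma measurable_laplace_pdf (R : realType) (A : set R) :
  measurable_fun A (@laplace_pdf R).
Proof.
apply: measurable_funS (@subsetT _ A) _ => //.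
by apply: continuous_measurable_fun; exact: continuous_laplace_pdf.
Qed.

Lemma laplace_prob_tail (R : realType) (a : R) : 0 <= a ->
  laplace_prob `]a, +oo[ = (2^-1 * expR (- a))%:E.
Proof.
move=> a0; rewrite /laplace_prob integral_itv_obnd_cbnd//; last first.
  by apply/measurable_EFinP; exact: measurable_laplace_pdf.
(* The derivative of [F] is exp(-x)/2, which agrees with the density only for x >= 0; this is where
   [0 <= a] enters. *)
pose F (x : R) := - (2^-1 * expR (- x)).
have dF (x : R) : is_derive x (1 : R) F (2^-1 * expR (- x)).
  by apply: is_derive_eq; rewrite /GRing.scale/=; lra.
rewrite (@ge0_continuous_FTC2y _ _ F a 0) => //.
- by rewrite /F EFinN oppeK add0e.
- by move=> x _; exact: laplace_pdf_ge0.
- by apply: continuous_subspaceT; exact: continuous_laplace_pdf.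
- rewrite -oppr0; apply: cvgN; rewrite -(mulr0 2^-1); apply: cvgMr.
  exact: cvgr_expR.
- apply/cvg_at_right_filter/differentiable_continuous/derivable1_diffP.
  exact: ex_derive.
- move=> x; rewrite in_itv/= andbT => ax.
  by rewrite derive1E derive_val /laplace_pdf gtr0_norm// (le_lt_trans a0).
Qed.

(** The density decreases on the nonnegative half-line, so on the interval it is at least its value
    at [b]. *)
Lemma laplace_prob_itv_ge (R : realType) (a b : R) : 0 <= a -> a < b ->
  ((2^-1 * expR (- b) * (b - a))%:E <= laplace_prob `[a, b]%classic)%E.
Proof.
move=> a0 ab.
have -> : ((2^-1 * expR (- b) * (b - a))%:E =
    \int[lebesgue_measure]_(x in `[a, b]) (cst (2^-1 * expR (- b))%:E x))%E.
  by rewrite integral_cst//= lebesgue_measure_itv/= lte_fin ab -EFinB -EFinM.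
apply: ge0_le_integral => //.
- by move=> x _; rewrite lee_fin mulr_ge0 ?expR_ge0// invr_ge0.
- by apply/measurable_EFinP; exact: measurable_laplace_pdf.
- move=> x /=; rewrite in_itv/= => /andP[ax xb].
  by rewrite lee_fin ler_pM2l ?invr_gt0// ler_expR lerN2 ger0_norm// (le_trans a0).
Qed.

(** For positive [z] this is monotonicity of the power; for [z <= 0], [Hbar] is 1, which bounds the
    exponential of any nonpositive number. *)
Lemma Hbar_ge (R : realType) (gamma delta z w : R) :
  0 <= gamma -> 0 <= delta -> 0 <= w -> z <= w ->
  expR (- (gamma * w `^ delta)) <= Hbar gamma delta z.
Proof.
move=> g0 d0 w0 zw; rewrite /Hbar !indicE.
case: (ltP 0 z) => z0.
  rewrite mem_set// memNset/= ?addr0 ?mulr1; last by apply/negP; rewrite -ltNge.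
  by rewrite ler_expR lerN2 ler_wpM2l// ge0_ler_powR// nnegrE ltW.
rewrite memNset/= ?mem_set//= ?mulr0 ?add0r; last by apply/negP; rewrite -leNgt.
by rewrite -expR0 ler_expR oppr_le0 mulr_ge0 ?powR_ge0.
Qed.

Lemma exists_powR_lt_id (R : realType) (s K u : R) :
  0 <= s < 1 -> exists t, [/\ 1 <= t, u < t & K * t `^ s < t].
Proof.
move=> /andP[s0 s1].
(* [M] exceeds both [u] and [K]. The witness t solves t = M t^s, and [1 <= M] makes t at least
   [M]. *)
pose M := 1 + `|u| + `|K|.
have M1 : 1 <= M by rewrite /M -addrA lerDl addr_ge0.
have Mt : M <= M `^ (1 - s)^-1.
  by apply: le1r_powR => //; rewrite invf_ge1; lra.
exists (M `^ (1 - s)^-1); split; first exact: le_trans Mt.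
  apply: lt_le_trans Mt; rewrite /M.
  by have := ler_norm u; have := normr_ge0 K; lra.
set t := _ `^ _ in Mt *.
have t0 : 0 < t by rewrite powR_gt0; lra.
have tE : t = M * t `^ s.
  have -> : M = t `^ (1 - s) by rewrite /t -powRrM mulVf ?powRr1; lra.
  by rewrite -powRD ?subrK ?powRr1 ?ltW// gt_eqF// implybT.
rewrite [ltRHS]tE ltr_pM2r; last exact: powR_gt0.
by rewrite /M; have := ler_norm K; have := normr_ge0 u; lra.
Qed.

(** Both sides are compared with P(X in A, Y in B), which is the integral of [k x B] over [A]
    against the law of [X]. *)
Lemma regular_cond_distribution_ge d (T : measurableType d) (R : realType)
    (P : probability T R) (X Y : {RV P >-> R}) (k : R.-pker R ~> R)
    (A B : set R) (c : R) :
  regular_cond_distribution X Y k -> measurable A -> measurable B ->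
  0 <= c -> (forall x, A x -> (c%:E <= k x B)%E) ->
  (c%:E * distribution P X A <= distribution P Y B)%E.
Proof.
move=> hk mA mB c0 ckB.
apply: (@le_trans _ _ (P (X @^-1` A `&` Y @^-1` B))); last first.
  rewrite /distribution/= /pushforward; apply: le_measure; rewrite ?inE//.
  - by apply: measurableI; rewrite -[_ @^-1` _]setTI; exact: measurable_funP.
  - by rewrite -[_ @^-1` _]setTI; exact: measurable_funP.
rewrite hk// -integral_cst//; apply: ge0_le_integral => //.
apply: measurable_funS (@subsetT _ A) _ => //.
exact: measurable_kernel.
Qed.

Theorem proposition3 (R : realType) (alpha beta gamma delta u : R)
    (halpha : 0 <= alpha < 1) (hbeta : 0 <= beta < 1)
    (hgamma : 0 < gamma) (hdelta : 1 <= delta) (hu : 0 < u)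
    (d : measure_display) (T : measurableType d) (P : probability T R)
    (X Y : {RV P >-> R})
    (hX : standard_laplace X) (hY : standard_laplace Y)
    (k : R.-pker R ~> R) (hk : regular_cond_distribution X Y k)
    (hH : forall x y : R, u < x ->
      k x [set t : R | y < t] =
        (Hbar gamma delta ((y - alpha * x) / x `^ beta))%:E) :
  (1 - beta)^-1 <= delta.
Proof.
have [a0 a1] := andP halpha; have [b0 b1] := andP hbeta.
have ob : 0 < 1 - beta by lra.
have d0 : 0 <= delta by lra.
(* The negated goal becomes (1 - beta) delta < 1. This product is the exponent [s] of [t] in w^delta
   below, so sublinearity of t^s yields a large [t] with gamma 4^delta t^s < t. *)
rewrite leNgt -[_^-1]mul1r ltr_pdivlMr// mulrC; apply/negP => s1.
set s := _ * _ in s1.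
have s0 : 0 <= s by rewrite mulr_ge0// ltW.
have [|t [t1 ut Kt]] := @exists_powR_lt_id _ s
  (gamma * 4 `^ delta) u; first by rewrite s0.
have t0 : 0 < t by lra.
(* [w] is 4t / t^beta. It bounds (4t - alpha x) / x^beta for every x >= t: dropping alpha x raises
   the numerator, and x^beta >= t^beta. *)
pose w := 4 * t `^ (1 - beta).
have kge x : t <= x ->
    ((expR (- (gamma * w `^ delta)))%:E <= k x `](4 * t)%R, +oo[%classic)%E.
  move=> tx; rewrite set_itvoy hH ?(lt_le_trans ut)// lee_fin.
  have x0 : 0 < x by lra.
  apply: Hbar_ge => //; first exact: ltW.
    by rewrite mulr_ge0 ?powR_ge0.
  rewrite ler_pdivrMr ?powR_gt0//.
  apply: (@le_trans _ _ (4 * t)); first by rewrite gerBl mulr_ge0// ltW.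
  rewrite -mulrA ler_pM2l// -[leLHS](powRr1 (ltW t0)) -[in leLHS](subrK beta 1).
  rewrite powRD ?(gt_eqF t0) ?implybT// ler_pM2l ?powR_gt0//.
  by apply: ge0_ler_powR; rewrite ?nnegrE// ltW.
have : ((expR (- (gamma * w `^ delta)))%:E *
    laplace_prob `[t, (2 * t)%R]%classic <=
    laplace_prob `](4 * t)%R, +oo[%classic)%E.
  rewrite -hX// -hY//; apply: regular_cond_distribution_ge hk _ _ _ _ => //.
  by move=> x /=; rewrite in_itv/= => /andP[+ _]; exact: kge.
have t2t : t < 2 * t by lra.
have itv_ge := laplace_prob_itv_ge R t (2 * t) (ltW t0) t2t.
move=> /(le_trans (lee_wpmul2l _ itv_ge)); rewrite lee_fin => /(_ (expR_ge0 _)).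
rewrite laplace_prob_tail; last lra.
rewrite -EFinM lee_fin.
have -> : gamma * w `^ delta = gamma * 4 `^ delta * t `^ s.
  by rewrite /w powRM ?powR_ge0// -powRrM mulrA.
set q := _ * t `^ s in Kt *.
(* The contradiction is exp(-4t) < exp(-q - 2t) t: by [q < t] the right exponent exceeds -3t, hence
   -4t, and the interval length [t] is at least 1. *)
apply/negP; rewrite -ltNge.
have -> : 2 * t - t = t by lra.
have -> : expR (- q) * (2^-1 * expR (- (2 * t)) * t)
   = 2^-1 * (expR (- q - 2 * t) * t) by rewrite expRD; lra.
rewrite ltr_pM2l ?invr_gt0//.
apply: (@lt_le_trans _ _ (expR (- q - 2 * t))); first by rewrite ltr_expR; lra.
by rewrite ler_peMr ?expR_ge0.
Qed.
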